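(* Let $m,\hbar>0$, let $V:\mathbb{R}\to\mathbb{R}$ be a real potential, and let $\Psi:\mathbb{R}^2\to\mathbb{C}$, $(t,x)\mapsto\Psi(t,x)$, be a $\mathcal{C}^2$ solution of the Schrödinger equation $\mathrm{i}\hbar\,\partial_t\Psi=\left[-\frac{\hbar^2}{2m}\partial_x^2+V(x)\right]\Psi$ on $\mathbb{R}^2$ such that $\Psi$ vanishes nowhere, $\int_{-\infty}^{\infty}|\Psi(t,\xi)|^2\,d\xi=1$ for all $t\in\mathbb{R}$, and the associated Bohmian velocity vector field $v$ on $\mathbb{R}^2$ is complete. Let $a<b$ be real numbers and let $D=\{(t,x)\in\mathbb{R}^2 : x\in[a,b],\ t\ge 0\}$. Let $P=P_D$ be the detection probability function of $D$. Then for all $\tau\ge 0$ $$P(\tau)=P(0)+\max\{f_a(s) : 0\le s\le\tau\}+\max\{-f_b(s) : 0\le s\le\tau\},$$ where $$f_a(s)=\int_0^s j(t,a)\,dt\qquad\text{and}\qquad f_b(s)=\int_0^s j(t,b)\,dt .$$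
   Context: Densities: $\rho=\Psi^*\Psi=|\Psi|^2$ and $j=\frac{\hbar}{m}\,\mathrm{Im}\{\Psi^*\,\partial_x\Psi\}$, functions on $\mathbb{R}^2$ (spacetime, with coordinates $(t,x)$). Bohmian velocity vector field: $v=\partial_t+\frac{j}{\rho}\,\partial_x$ on $\mathbb{R}^2$; it is $\mathcal{C}^1$ since $\Psi$ is $\mathcal{C}^2$ and nowhere zero. For $p\in\mathbb{R}^2$ let $\gamma_p$ be the maximal integral curve of $v$ with $\gamma_p(0)=p$. Completeness of $v$ means that every $\gamma_p$ is defined on all of $\mathbb{R}$. The $t$-coordinate of $\gamma_p(s)$ equals $s+t(p)$, where $t(p)$ is the $t$-coordinate of $p$; hence each integral curve meets the line $\{t=0\}$ in exactly one point. Fibre projection: $\mathcal{X}_0:\mathbb{R}^2\to\mathbb{R}$ sends $p$ to the $x$-coordinate of the unique point where the integral curve of $v$ through $p$ meets $\{t=0\}$, i.e. $\mathcal{X}_0(p)$ is the $x$-coordinate of $\gamma_p(-t(p))$. Detection probability: for $D\subseteq\mathbb{R}^2$ and $\tau\in\mathbb{R}$ put $D_\tau=\{p\in D : t(p)\le\tau\}$. If $\mathcal{X}_0(D_\tau)$ is a Borel set for every $\tau\in\mathbb{R}$, the detection probability function of $D$ is $$P_D(\tau)=\int_{\mathcal{X}_0(D_\tau)}\rho(0,\xi)\,d\xi .$$ *)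

(* Defs.v *)
(* MathComp-Analysis; wave functions take values in R[i] from real-closed. *)
From HB Require Import structures.
From mathcomp Require Import all_boot all_order all_algebra.
From mathcomp Require Import complex.
From mathcomp Require Import all_classical all_reals all_analysis.

Set Implicit Arguments.
Unset Strict Implicit.
Unset Printing Implicit Defensive.

Import Order.TTheory GRing.Theory Num.Theory.
Import numFieldNormedType.Exports.

Local Open Scope classical_set_scope.
Local Open Scope ring_scope.

(* Points of spacetime are pairs p = (t, x) : R * R. *)

Definition pdt (R : realType) (f : R * R -> R) (p : R * R) : R :=
  'D_((1, 0) : R * R) f p.

Definition pdx (R : realType) (f : R * R -> R) (p : R * R) : R :=
  'D_((0, 1) : R * R) f p.

(* C^k: all partial derivatives up to order k exist and are continuous.  The
   derivability clauses matter: 'D_v f p is a default value where the limit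
   does not exist. *)
Fixpoint class_C (R : realType) (k : nat) (f : R * R -> R) : Prop :=
  if k is k'.+1 then
    [/\ continuous f,
        forall p, derivable f p ((1, 0) : R * R),
        forall p, derivable f p ((0, 1) : R * R),
        class_C k' (pdt f) & class_C k' (pdx f)]
  else continuous f.

(* R[i] carries no normed R-module structure in the library, so regularity and
   partial derivatives of complex-valued functions are taken componentwise. *)
Definition class_CC (R : realType) (k : nat) (Psi : R * R -> R[i]) : Prop :=
  class_C k (fun p => complex.Re (Psi p)) /\
  class_C k (fun p => complex.Im (Psi p)).

Definition pdtC (R : realType) (Psi : R * R -> R[i]) (p : R * R) : R[i] :=
  Complex (pdt (fun q => complex.Re (Psi q)) p)
          (pdt (fun q => complex.Im (Psi q)) p).

Definition pdxC (R : realType) (Psi : R * R -> R[i]) (p : R * R) : R[i] :=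
  Complex (pdx (fun q => complex.Re (Psi q)) p)
          (pdx (fun q => complex.Im (Psi q)) p).

Definition schroedinger (R : realType) (hbar m : R) (V : R -> R)
    (Psi : R * R -> R[i]) : Prop :=
  forall p : R * R,
    ((0 +i* 1) * hbar%:C * pdtC Psi p =
     - (hbar ^+ 2 / (2 * m))%:C * pdxC (pdxC Psi) p + (V p.2)%:C * Psi p)%C.

Definition density (R : realType) (Psi : R * R -> R[i]) (p : R * R) : R :=
  complex.Re ((Psi p)^*%C * Psi p).

Definition current (R : realType) (hbar m : R) (Psi : R * R -> R[i])
    (p : R * R) : R :=
  hbar / m * complex.Im ((Psi p)^*%C * pdxC Psi p).

Definition bohm_velocity (R : realType) (hbar m : R) (Psi : R * R -> R[i])
    (p : R * R) : R * R :=
  (1, current hbar m Psi p / density Psi p).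

(* Curves are total functions, of which only the restriction to the open
   interval I is meaningful. *)
Definition integral_curve (R : realType) (v : R * R -> R * R) (p : R * R)
    (I : set R) (gamma : R -> R * R) : Prop :=
  [/\ open I, is_interval I, I 0, gamma 0 = p &
      forall s, I s -> is_derive s (1 : R) gamma (v (gamma s))].

Definition maximal_integral_curve (R : realType) (v : R * R -> R * R)
    (p : R * R) (I : set R) (gamma : R -> R * R) : Prop :=
  integral_curve v p I gamma /\
  forall J delta, integral_curve v p J delta -> I `<=` J ->
    (forall s, I s -> delta s = gamma s) -> J = I.

Definition complete_field (R : realType) (v : R * R -> R * R) : Prop :=
  forall p, exists gamma, maximal_integral_curve v p setT gamma.

(* The maximal integral curve through p of a complete field v (for a C^1 field
   it is unique); the constant curve is a dummy value when there is none. *)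
Definition flow_curve (R : realType) (v : R * R -> R * R) (p : R * R) :
    R -> R * R :=
  xget (cst p) [set gamma | maximal_integral_curve v p setT gamma].

Definition fibre_proj (R : realType) (v : R * R -> R * R) (p : R * R) : R :=
  (flow_curve v p (- p.1)).2.

Definition upto (R : realType) (D : set (R * R)) (tau : R) : set (R * R) :=
  [set p | D p /\ p.1 <= tau].

(* Meaningful when the domain of integration is a Borel set. *)
Definition detection_prob (R : realType) (hbar m : R) (Psi : R * R -> R[i])
    (D : set (R * R)) (tau : R) : R :=
  Rintegral lebesgue_measure
    (fibre_proj (bohm_velocity hbar m Psi) @` upto D tau)
    (fun xi => density Psi (0, xi)).

(* int_0^s j(t, c) dt, for s >= 0 *)
Definition flux (R : realType) (hbar m : R) (Psi : R * R -> R[i])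
    (c s : R) : R :=
  Rintegral lebesgue_measure `[0, s] (fun t => current hbar m Psi (t, c)).

Definition is_max (R : realType) (A : set R) (M : R) : Prop :=
  A M /\ ubound A M.

(* Main.v *)
(** Since [d_t rho + d_x j = 0], the 1-form [rho dx - j dt] has a potential
    [F(t, x) = \int_(-oo)^x rho(-1, y) dy - \int_(-1)^t j(s, x) ds] on [t > -1].
    It is constant along the Bohmian trajectories and increasing in [x], so [F]
    determines the fibre projection by [F(0, X0 p) = F(p)] and no uniqueness theorem
    for integral curves is needed.  Hence [X0(D_tau)] is the segment on which
    [F(0, .)] runs from [min F(., a)] to [max F(., b)] over [[0, tau]], and its
    mass is [max F(., b) - min F(., a)], while [f_c(s) = F(0, c) - F(s, c)]. *)

Require Import Defs.
From HB Require Import structures.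
From mathcomp Require Import all_boot all_order all_algebra.
From mathcomp Require Import complex.
From mathcomp Require Import ring.
From mathcomp Require Import all_classical all_reals all_analysis.
From mathcomp Require Import measurable_realfun.

Import Order.TTheory GRing.Theory Num.Theory.
Import numFieldNormedType.Exports.

Local Open Scope classical_set_scope.
Local Open Scope ring_scope.

Set Implicit Arguments.
Unset Strict Implicit.

(** * Partial derivatives and slices as one-variable notions *)

Lemma is_derive_pdt (R : realType) (f : R * R -> R) (t x : R) :
  derivable f (t, x) ((1, 0) : R * R) ->
  is_derive t (1 : R) (fun s => f (s, x)) (pdt f (t, x)).
Proof.
move=> df.
(* The two difference quotients agree as functions of [h], so existence of the limit and its value
   transfer together. *)
suff E : (fun h : R => h^-1 *: (((fun s => f (s, x)) \o shift t) (h *: (1 : R)) -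
            f (t, x))) =
         (fun h : R => h^-1 *: ((f \o shift (t, x)) (h *: ((1, 0) : R * R)) -
            f (t, x))).
  by split; rewrite /derivable /pdt /derive E.
apply/funext => h /=; congr (_ *: (f _ - _)).
have E0 : h *: (0 : R) + x = x by rewrite scaler0 add0r.
by apply/esym; congr (_, _); exact: E0.
Qed.

Lemma is_derive_pdx (R : realType) (f : R * R -> R) (t x : R) :
  derivable f (t, x) ((0, 1) : R * R) ->
  is_derive x (1 : R) (fun y => f (t, y)) (pdx f (t, x)).
Proof.
move=> df.
suff E : (fun h : R => h^-1 *: (((fun y => f (t, y)) \o shift x) (h *: (1 : R)) -
            f (t, x))) =
         (fun h : R => h^-1 *: ((f \o shift (t, x)) (h *: ((0, 1) : R * R)) -
            f (t, x))).
  by split; rewrite /derivable /pdx /derive E.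
apply/funext => h /=; congr (_ *: (f _ - _)).
have E0 : h *: (0 : R) + t = t by rewrite scaler0 add0r.
by apply/esym; congr (_, _); exact: E0.
Qed.

Lemma continuous_slice1 (R : realType) (f : R * R -> R) (x : R) :
  continuous f -> continuous (fun t => f (t, x)).
Proof.
move=> cf t; apply: (cvg_comp (fun s : R => (s, x)) f _ (cf _)).
exact: (cvg_pair (cvg_id : s @[s --> t] --> t) (cvg_cst x)).
Qed.

Lemma continuous_slice2 (R : realType) (f : R * R -> R) (t : R) :
  continuous f -> continuous (fun x => f (t, x)).
Proof.
move=> cf x; apply: (cvg_comp (fun y : R => (t, y)) f _ (cf _)).
exact: (cvg_pair (cvg_cst t) (cvg_id : s @[s --> x] --> x)).
Qed.

(** * One-variable calculus *)

Lemma is_derive1_continuous (R : realType) (f : R -> R) (x l : R) :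
  is_derive x (1 : R) f l -> {for x, continuous f}.
Proof. by move=> [df _]; apply: differentiable_continuous; exact/derivable1_diffP. Qed.

Lemma itv_continuous_is_derive (R : realType) (f f' : R -> R) (a b : R) :
  (forall x, x \in `[a, b] -> is_derive x (1 : R) f (f' x)) ->
  {within `[a, b], continuous f}.
Proof.
move=> df; apply: derivable_within_continuous => x /df [] //.
Qed.

(** The degenerate case [a = b] is included because the flux is also evaluated at [s = 0]. *)
Lemma continuous_Rintegral_itv_FTC2 (R : realType) (f F : R -> R) (a b : R) :
  a <= b -> continuous f ->
  (forall x, x \in `[a, b] -> is_derive x (1 : R) F (f x)) ->
  Rintegral lebesgue_measure `[a, b] f = F b - F a.
Proof.
rewrite le_eqVlt => /predU1P[<- _ _|ab cf dF].
  by rewrite set_itv1 Rintegral_set1 subrr.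
have cF x : x \in `[a, b] -> {for x, continuous F}.
  by move=> xab; exact: is_derive1_continuous (dF x xab).
rewrite /Rintegral (@continuous_FTC2 _ f F) //.
- by apply: continuous_subspaceT => x; exact: cf.
- split.
  + by move=> x /subset_itv_oo_cc /dF [].
  + by apply: cvg_at_right_filter; apply: cF; rewrite in_itv/= lexx ltW.
  + by apply: cvg_at_left_filter; apply: cF; rewrite in_itv/= lexx ltW.
- by move=> x /subset_itv_oo_cc /dF [_ <-]; rewrite derive1E.
Qed.

(** Increments in the chain rule below have either sign. Bounding the distance from [c] to [x] makes
    [c] tend to [x] along with [y]. *)
Lemma MVT_unordered (R : realType) (f f' : R -> R) :
  (forall x, is_derive x (1 : R) f (f' x)) ->
  forall x y, exists c, `|c - x| <= `|y - x| /\ f y - f x = f' c * (y - x).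
Proof.
move=> df.
have cf a b : {within `[a, b], continuous f}.
  by apply: itv_continuous_is_derive => x _; exact: df.
move=> x y; have [xy|/ltW yx] := leP x y.
  have [c + ->] := MVT_segment xy (fun z _ => df z) (cf x y).
  rewrite in_itv/= => /andP[xc cy]; exists c; split => //.
  by rewrite !ger0_norm ?subr_ge0// lerD2r.
have [c + E] := MVT_segment yx (fun z _ => df z) (cf y x).
rewrite in_itv/= => /andP[yc cx]; exists c; split.
  by rewrite !ler0_norm ?subr_le0// lerN2 lerD2r.
by rewrite -opprB E -mulrN opprB.
Qed.

(** * Chain rule along a curve in the plane *)

Lemma is_derive_quotient (R : realType) (f : R -> R) (s l : R) :
  is_derive s (1 : R) f l ->
  h^-1 *: (f (h + s) - f s) @[h --> (0:R)^'] --> l.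
Proof.
by move=> [df <-]; rewrite /derive; move: df; rewrite /derivable;
  under eq_fun do rewrite /= /shift /= scaler1.
Qed.

Lemma quotient_is_derive (R : realType) (f : R -> R) (s l : R) :
  h^-1 *: (f (h + s) - f s) @[h --> (0:R)^'] --> l ->
  is_derive s (1 : R) f l.
Proof.
move=> H; have H' : h^-1 *: ((f \o shift s) (h *: (1 : R)) - f s) @[h --> (0:R)^'] --> l.
  by under eq_fun do rewrite /= /shift /= scaler1.
split; last exact/cvg_lim.
by apply/cvg_ex; exists l.
Qed.

(** The increment is split at the intermediate point [(g (h + s), k s)]. The change in the first
    variable falls under the one-variable chain rule; the change in the second is, by the mean value
    theorem, a value of [B] times the increment of [k], and [B] is continuous. *)
Lemma is_derive_comp2 (R : realType) (t0 : R) (F : R -> R -> R) (A B : R * R -> R)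
    (g k : R -> R) (s g' k' : R) :
  (forall t x, t0 < t -> is_derive t (1 : R) (F^~ x) (A (t, x))) ->
  (forall t x, t0 < t -> is_derive x (1 : R) (F t) (B (t, x))) ->
  continuous B -> t0 < g s ->
  is_derive s (1 : R) g g' -> is_derive s (1 : R) k k' ->
  is_derive s (1 : R) (fun u => F (g u) (k u))
    (A (g s, k s) * g' + B (g s, k s) * k').
Proof.
move=> dA dB cB t0g dg dk; apply: quotient_is_derive.
have shift_cvg (f : R -> R) l : is_derive s (1 : R) f l ->
    f (h + s) @[h --> (0:R)^'] --> f s.
  move=> /is_derive1_continuous cf; apply: cvg_within_filter.
  apply: (cvg_comp (fun h => h + s) f); last exact: cf.
  have : h + s @[h --> (0:R)] --> 0 + s by apply: cvgD; [exact: cvg_id|exact: cvg_cst].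
  by rewrite add0r.
(* The mean value point becomes a total function of [h], so that its limit can be taken. Where
   [g (h + s)] is not above [t0], the default [k s] keeps the distance bound true. *)
have /choice[xi Hxi] (h : R) : exists c,
    `|c - k s| <= `|k (h + s) - k s| /\ (t0 < g (h + s) ->
      F (g (h + s)) (k (h + s)) - F (g (h + s)) (k s) =
      B (g (h + s), c) * (k (h + s) - k s)).
  have [t0gh|_] := ltP t0 (g (h + s)).
    have [c [cle cE]] := MVT_unordered (fun x => dB _ x t0gh) (k s) (k (h + s)).
    by exists c.
  by exists (k s); rewrite subrr normr0.
have cxi : xi h @[h --> (0:R)^'] --> k s.
  apply/cvgrPdist_le => e e0; near=> h; rewrite distrC.
  rewrite (le_trans (Hxi h).1)// distrC; near: h.
  by move/cvgrPdist_le : (shift_cvg _ _ dk); exact.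
have dF1 := is_derive_quotient (is_derive1_comp (dA _ (k s) t0g) dg).
apply: cvg_trans (cvgD dF1 (cvgM (_ : B (g (h + s), xi h) @[h --> (0:R)^'] -->
   B (g s, k s)) (is_derive_quotient dk))); last first.
  apply: (cvg_comp (fun h : R => (g (h + s), xi h)) B); last exact: cB.
  exact: (cvg_pair (shift_cvg _ _ dg) cxi).
apply: near_eq_cvg; near=> h.
have t0gh : t0 < g (h + s).
  by near: h; apply: (cvgr_gt (g s)) => //; exact: shift_cvg dg.
rewrite -[LHS]/(h^-1 * (F (g (h + s)) (k s) - F (g s) (k s)) +
  B (g (h + s), xi h) * (h^-1 * (k (h + s) - k s))).
rewrite mulrCA -(Hxi h).2// -mulrDr.
by congr (_ * _); rewrite addrC addrA subrK.
Unshelve. all: by end_near. Qed.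

(** * The potential and its partial derivatives *)

Lemma continuous_bounded_rectangle (R : realType) (f : R * R -> R) (a b c d : R) :
  continuous f -> exists2 M, 0 <= M &
    forall t x, t \in `[a, b] -> x \in `[c, d] -> `|f (t, x)| <= M.
Proof.
move=> cf.
have /compact_bounded[M [_ /(_ (`|M| + 1))]] :
    compact (f @` (`[a, b]%classic `*` `[c, d]%classic)).
  apply: continuous_compact; last by apply: compact_setX; exact: segment_compact.
  by apply: continuous_subspaceT; exact: cf.
rewrite (le_lt_trans (ler_norm _)) ?ltrDl// => /(_ erefl) H.
exists (`|M| + 1); first by rewrite addr_ge0.
by move=> t x tab xcd; apply: H; exists (t, x).
Qed.

Section potential.
Context (R : realType) (r j rt : R * R -> R) (t0 : R).
Hypothesis r_cont : continuous r.
Hypothesis j_cont : continuous j.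
Hypothesis rt_cont : continuous rt.
Hypothesis dr : forall t x, is_derive t (1 : R) (fun s => r (s, x)) (rt (t, x)).
Hypothesis dj : forall t x, is_derive x (1 : R) (fun y => j (t, y)) (- rt (t, x)).
Hypothesis r_int :
  lebesgue_measure.-integrable [set: R] (EFin \o (fun x => r (t0, x))).

(* The base time [t0] lies strictly below the times of interest, so that the
   derivatives in [t] are two-sided there. *)
Definition potential (t x : R) : R :=
  Rintegral lebesgue_measure `]-oo, x] (fun y => r (t0, y)) -
  Rintegral lebesgue_measure `[t0, t] (fun s => j (s, x)).

Let jx_int t x : lebesgue_measure.-integrable `[t0, t] (EFin \o (fun s => j (s, x))).
Proof.
apply: continuous_compact_integrable; first exact: segment_compact.
by apply: continuous_subspaceT => s; exact: continuous_slice1.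
Qed.

Lemma is_derive_potential1 t x : t0 < t ->
  is_derive t (1 : R) (potential^~ x) (- j (t, x)).
Proof.
move=> t0t.
(* The integrand is considered up to [t + 1] so that [t] is an interior point and the derivative is
   two-sided. *)
have [d1 d2] := @continuous_FTC1_closed R (fun s => j (s, x)) t0 t (t + 1)
  (ltr_pwDr ltr01 (lexx t)) (jx_int _ _) t0t (@continuous_slice1 R j x j_cont t).
rewrite -(sub0r (j _)); apply: is_deriveB; rewrite -d2 derive1E.
exact: derivableP.
Qed.

(** The first integral contributes [r (t0, x)]. Differentiating the second under the integral sign
    gives the integral of [- rt (s, x)] over [[t0, t]], which is [r (t0, x) - r (t, x)]; the
    difference is [r (t, x)]. *)
Lemma is_derive_potential2 t x : t0 < t ->
  is_derive x (1 : R) (potential t) (r (t, x)).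
Proof.
move=> t0t.
have ri : lebesgue_measure.-integrable `]-oo, (x + 1)] (EFin \o (fun y => r (t0, y))).
  by apply: (integrableS _ _ _ r_int).
have [d1 d2] := @continuous_FTC1 R (fun y => r (t0, y)) -oo%O x (x + 1)
  (ltr_pwDr ltr01 (lexx x)) ri
  (ltNyr x) (@continuous_slice2 R r t0 r_cont x).
have -> : r (t, x) = r (t0, x) - (r (t0, x) - r (t, x)) by rewrite opprB addrC subrK.
apply: is_deriveB.
  by rewrite -[X in is_derive _ _ _ X]d2 derive1E; exact: derivableP.
(* The constant [M] is the integrable dominating function on [[t0, t]], valid for all [y] within
   distance 1 of [x]. *)
have [M M0 Mrt] := continuous_bounded_rectangle t0 t (x - 1) (x + 1) rt_cont.
have dj1 s y : partial1of2 (fun y s => j (s, y)) y s = - rt (s, y).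
  by rewrite partial1of2E; have [_] := dj s y.
have <- : Rintegral lebesgue_measure `[t0, t]
    (partial1of2 (fun y s => j (s, y)) x) = r (t0, x) - r (t, x).
  rewrite (_ : partial1of2 _ _ = fun s => - rt (s, x)); last exact/funext.
  rewrite (@continuous_Rintegral_itv_FTC2 R _ (fun s => - r (s, x))).
  - by rewrite opprK addrC.
  - exact: ltW.
  - by move=> s; apply: continuousN; exact: continuous_slice1.
apply: quotient_is_derive.
have xx1 : `]x - 1, x + 1[%classic x by rewrite /= in_itv/= ltrBlDr !ltrDl ltr01.
apply: (@cvg_differentiation_under_integral R _ _ lebesgue_measure
  (fun y s => j (s, y)) `[t0, t]%classic (measurable_itv _) x (x - 1) (x + 1) xx1
  (fun y _ => jx_int t y) _ (cst M) (fun=> M0)).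
- by move=> y s _ _; have [] := dj s y.
- apply: continuous_compact_integrable; first exact: segment_compact.
  by apply: continuous_subspaceT => s; exact: cvg_cst.
- move=> y s /subset_itv_oo_cc ys st; rewrite dj1 normrN; exact: Mrt.
Qed.

End potential.

(** * Integral curves, the potential along them, and the image of the strip *)

Lemma is_derive_fst (R : realType) (g : R -> R * R) (s : R) (l : R * R) :
  is_derive s (1 : R) g l -> is_derive s (1 : R) (fun u => (g u).1) l.1.
Proof.
move=> [/cvg_ex[l' gl'] dg].
have E : l' = l by rewrite -dg; apply/esym/cvg_lim.
have cl : h^-1 *: ((((fun u => (g u).1) \o shift s) (h *: (1 : R))) - (g s).1)
    @[h --> (0:R)^'] --> l.1.
  rewrite -E; exact: (cvg_comp _ fst gl' (@cvg_fst _ _ (nbhs l'.1) (nbhs l'.2) _)).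
by split; [apply/cvg_ex; exists l.1|exact/cvg_lim].
Qed.

Lemma is_derive_snd (R : realType) (g : R -> R * R) (s : R) (l : R * R) :
  is_derive s (1 : R) g l -> is_derive s (1 : R) (fun u => (g u).2) l.2.
Proof.
move=> [/cvg_ex[l' gl'] dg].
have E : l' = l by rewrite -dg; apply/esym/cvg_lim.
have cl : h^-1 *: ((((fun u => (g u).2) \o shift s) (h *: (1 : R))) - (g s).2)
    @[h --> (0:R)^'] --> l.2.
  rewrite -E; exact: (cvg_comp _ snd gl' (@cvg_snd _ _ (nbhs l'.1) (nbhs l'.2) _)).
by split; [apply/cvg_ex; exists l.2|exact/cvg_lim].
Qed.

(** The time component of the field is 1, so [(gamma s).1 - s] has derivative zero. *)
Lemma integral_curve_time (R : realType) (u : R * R -> R) (p : R * R)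
    (gamma : R -> R * R) :
  integral_curve (fun q => (1, u q)) p setT gamma ->
  forall s, (gamma s).1 = s + p.1.
Proof.
move=> [_ _ _ <- dg] s.
suff : (gamma s).1 - s = (gamma 0).1 - 0 by rewrite subr0 => <-; rewrite addrC subrK.
apply: (@is_derive_0_is_cst _ (fun s => (gamma s).1 - s)) => x.
rewrite -(subrr (1 : R)); apply: is_deriveB.
exact: (is_derive_fst (dg x I)).
Qed.

(** By the chain rule the derivative of [F] along the curve is [- j + r * (j / r) = 0]. The
    parameters [0] and [- p.1] correspond to [p] and to the crossing of the line of time 0. *)
Lemma potential_integral_curve (R : realType) (F : R -> R -> R) (r j : R * R -> R)
    (t0 : R) (p : R * R) (gamma : R -> R * R) :
  (forall t x, t0 < t -> is_derive t (1 : R) (F^~ x) (- j (t, x))) ->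
  (forall t x, t0 < t -> is_derive x (1 : R) (F t) (r (t, x))) ->
  continuous r -> (forall q, r q != 0) ->
  integral_curve (fun q => (1, j q / r q)) p setT gamma ->
  t0 < 0 -> 0 <= p.1 -> F 0 (gamma (- p.1)).2 = F p.1 p.2.
Proof.
move=> dF1 dF2 cr r0 gI t00 p0.
have gt := integral_curve_time gI.
case: gI => _ _ _ g0 dg.
pose H s := F (gamma s).1 (gamma s).2.
(* For these parameters the time [s + p.1] is nonnegative, hence above [t0], where the derivatives
   of [F] are known. *)
have dH s : s \in `[- p.1, 0] -> is_derive s (1 : R) H ((fun=> 0) s).
  rewrite in_itv/= => /andP[ps _].
  have t0g : t0 < (gamma s).1 by rewrite gt (lt_le_trans t00)// -lerBlDr sub0r.
  have := @is_derive_comp2 R t0 F (fun q => - j q) r _ _ _ _ _ dF1 dF2 cr t0g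
    (is_derive_fst (dg s I)) (is_derive_snd (dg s I)).
  by rewrite -surjective_pairing mulr1 mulrCA divff// mulr1 addNr.
have Np0 : - p.1 <= 0 by rewrite oppr_le0.
have [c _] := MVT_segment Np0
  (fun z zz => dH z (subset_itv_oo_cc zz)) (itv_continuous_is_derive dH).
by rewrite mul0r => /eqP; rewrite subr_eq0 /H g0 gt addNr => /eqP ->.
Qed.

(** As [F 0] is strictly increasing, positions on the line of time 0 are compared through their
    [F]-values. One inclusion is the chain [F ta a <= F t a <= F t x <= F t b <= F tb b]; the other
    asks for a point of the strip with a prescribed value of [F]. *)
Lemma fibre_image (R : realType) (F : R -> R -> R) (X : R * R -> R)
    (a b tau ta tb : R) :
  (forall t, 0 <= t -> {homo F t : x y / x < y}) ->
  continuous (F 0) ->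
  (forall x, {within `[0, tau], continuous (F^~ x)}) ->
  (forall p, 0 <= p.1 -> F 0 (X p) = F p.1 p.2) ->
  a <= b -> 0 <= tau ->
  ta \in `[0, tau] -> (forall t, t \in `[0, tau] -> F ta a <= F t a) ->
  tb \in `[0, tau] -> (forall t, t \in `[0, tau] -> F t b <= F tb b) ->
  X @` upto [set p | p.2 \in `[a, b] /\ 0 <= p.1] tau = `[X (ta, a), X (tb, b)]%classic.
Proof.
move=> Finc F0c Fc FX ab tau0 taP amin tbP bmax.
have F0mono := le_mono (Finc 0 (lexx 0)).
have F0inj := inc_inj F0mono.
have [ta0 tatau] : 0 <= ta /\ ta <= tau by move: taP; rewrite in_itv/= => /andP.
have [tb0 tbtau] : 0 <= tb /\ tb <= tau by move: tbP; rewrite in_itv/= => /andP.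
have cW c d (x : R) : 0 <= c -> d <= tau -> {within `[c, d], continuous (F^~ x)}.
  by move=> c0 dtau; apply: continuous_subspaceW (Fc x); exact: subset_itvScc.
have FXa : F 0 (X (ta, a)) = F ta a by exact: FX.
have FXb : F 0 (X (tb, b)) = F tb b by exact: FX.
apply/seteqP; split => [_ /= [[t x] /= [[+ t0] ttau] <-]|y /=].
  rewrite /= !in_itv/= => /andP[ax xb].
  rewrite -(F0mono (X (ta, a))) -(F0mono _ (X (tb, b))) FXa FXb FX//=.
  have tP : t \in `[0, tau] by rewrite in_itv/= t0.
  have Ft := le_mono (Finc t t0).
  by rewrite (le_trans (amin t tP)) ?Ft// (le_trans _ (bmax t tP)) ?Ft.
rewrite in_itv/= -(F0mono (X (ta, a))) -(F0mono _ (X (tb, b))) FXa FXb => /andP[ya yb].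
suff [t [x [t0 ttau xab Ftx]]] : exists t x,
    [/\ 0 <= t, t <= tau, x \in `[a, b] & F t x = F 0 y].
  by exists (t, x) => //=; apply: F0inj; rewrite FX.
(* The value [F 0 y] is attained on one of the sides [x = a], [x = b], [t = 0]
   of the strip, so the one-dimensional intermediate value theorem suffices. *)
have [yFa|Fay] := leP (F 0 y) (F 0 a).
  have [|t tP Ft] := IVT (v := F 0 y) ta0 (cW _ _ a (lexx 0) tatau).
    by rewrite ge_min le_max ya yFa orbT.
  exists t, a; move: tP; rewrite in_itv/= => /andP[t0 tta].
  by split => //; [exact: le_trans tatau|rewrite in_itv/= lexx].
have [Fby|yFb] := leP (F 0 b) (F 0 y).
  have [|t tP Ft] := IVT (v := F 0 y) tb0 (cW _ _ b (lexx 0) tbtau).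
    by rewrite ge_min le_max yb Fby orbT.
  exists t, b; move: tP; rewrite in_itv/= => /andP[t0 ttb].
  by split => //; [exact: le_trans tbtau|rewrite in_itv/= lexx andbT].
exists 0, y; split => //.
by rewrite in_itv/= -(F0mono a) -(F0mono _ b) !ltW.
Qed.

(** * Density, current and the continuity equation *)

Lemma densityE (R : realType) (Psi : R * R -> R[i]) (p : R * R) :
  density Psi p = complex.Re (Psi p) ^+ 2 + complex.Im (Psi p) ^+ 2.
Proof. by rewrite /density; case: (Psi p) => x y /=; ring. Qed.

Lemma density_gt0 (R : realType) (Psi : R * R -> R[i]) (p : R * R) :
  Psi p != 0 -> 0 < density Psi p.
Proof.
rewrite densityE lt0r addr_ge0 ?sqr_ge0// andbT paddr_eq0 ?sqr_ge0// !sqrf_eq0.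
by case: (Psi p) => x y; rewrite eq_complex.
Qed.

Lemma currentE (R : realType) (hbar m : R) (Psi : R * R -> R[i]) (p : R * R) :
  current hbar m Psi p =
  hbar / m * (complex.Re (Psi p) * pdx (fun q => complex.Im (Psi q)) p -
              complex.Im (Psi p) * pdx (fun q => complex.Re (Psi q)) p).
Proof.
rewrite /current /pdxC; congr (_ * _).
by case: (Psi p) => x y /=; ring.
Qed.

(** This explicit expression, visibly continuous for a C^2 wave function, serves both as the time
    derivative of the density and as minus the space derivative of the current. *)
Definition density_dt (R : realType) (Psi : R * R -> R[i]) (p : R * R) : R :=
  2 * (complex.Re (Psi p) * pdt (fun q => complex.Re (Psi q)) p +
       complex.Im (Psi p) * pdt (fun q => complex.Im (Psi q)) p).

Section continuity_equation.
Context (R : realType) (m hbar : R) (V : R -> R) (Psi : R * R -> R[i]).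
Hypothesis m_gt0 : 0 < m.
Hypothesis hbar_gt0 : 0 < hbar.
Hypothesis Psi_C2 : class_CC 2 Psi.
Hypothesis Psi_eq : schroedinger hbar m V Psi.

Let re p := complex.Re (Psi p).
Let im p := complex.Im (Psi p).

Lemma continuous_density : continuous (density Psi).
Proof.
have [[cre _ _ _ _] [cim _ _ _ _]] := Psi_C2.
rewrite (_ : density Psi = fun p => re p * re p + im p * im p); last first.
  by apply/funext => p; rewrite densityE.
by move=> p; exact: (cvgD (cvgM (cre p) (cre p)) (cvgM (cim p) (cim p))).
Qed.

Lemma continuous_current : continuous (current hbar m Psi).
Proof.
have [[cre _ _ _ [cxre _ _ _ _]] [cim _ _ _ [cxim _ _ _ _]]] := Psi_C2.
rewrite (_ : current hbar m Psi = fun p => hbar / m *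
    (re p * pdx im p - im p * pdx re p)); last first.
  by apply/funext => p; rewrite currentE.
move=> p; exact: (cvgM (cvg_cst (hbar / m))
  (cvgB (cvgM (cre p) (cxim p)) (cvgM (cim p) (cxre p)))).
Qed.

Lemma continuous_density_dt : continuous (density_dt Psi).
Proof.
have [[cre _ _ [ctre _ _ _ _] _] [cim _ _ [ctim _ _ _ _] _]] := Psi_C2.
rewrite -[density_dt Psi]/(fun p => 2 * (re p * pdt re p + im p * pdt im p)).
move=> p; exact: (cvgM (cvg_cst (2 : R))
  (cvgD (cvgM (cre p) (ctre p)) (cvgM (cim p) (ctim p)))).
Qed.

Lemma is_derive_density t x :
  is_derive t (1 : R) (fun s => density Psi (s, x)) (density_dt Psi (t, x)).
Proof.
have [[_ dre _ _ _] [_ dim _ _ _]] := Psi_C2.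
have dr := is_derive_pdt (dre (t, x)); have di := is_derive_pdt (dim (t, x)).
rewrite (_ : (fun s => density Psi (s, x)) =
    fun s => re (s, x) * re (s, x) + im (s, x) * im (s, x)); last first.
  by apply/funext => s; rewrite densityE.
apply: is_derive_eq (is_deriveD (is_deriveM dr dr) (is_deriveM di di)) _.
rewrite /density_dt /GRing.scale /=; ring.
Qed.

(** In the derivative of [re * pdx im - im * pdx re] the products of first derivatives cancel.
    Second space derivatives and time derivatives are related by the Schroedinger equation, whose
    potential terms cancel because [V] is real. *)
Lemma is_derive_current t x :
  is_derive x (1 : R) (fun y => current hbar m Psi (t, y)) (- density_dt Psi (t, x)).
Proof.
have [[_ _ dre _ [_ _ dxre _ _]] [_ _ dim _ [_ _ dxim _ _]]] := Psi_C2.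
have dr := is_derive_pdx (dre (t, x)); have di := is_derive_pdx (dim (t, x)).
have dxr := is_derive_pdx (dxre (t, x)); have dxi := is_derive_pdx (dxim (t, x)).
rewrite (_ : (fun y => current hbar m Psi (t, y)) = fun y => hbar / m *
    (re (t, y) * pdx im (t, y) - im (t, y) * pdx re (t, y))); last first.
  by apply/funext => s; rewrite currentE.
apply: is_derive_eq (is_deriveM (is_derive_cst (hbar / m) x 1)
  (is_deriveB (is_deriveM dr dxi) (is_deriveM di dxr))) _.
have := Psi_eq (t, x).
rewrite /density_dt /pdtC /pdxC /=.
have -> : Psi (t, x) = (re (t, x) +i* im (t, x))%C by rewrite /re /im; case: (Psi _).
rewrite /=.
(* [a] and [b] are the time derivatives of the real and imaginary parts, [c] and [d] their second
   space derivatives. The real part [E1] of the equation determines [b], the imaginary part [E2]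
   determines [a]. *)
set a := pdt _ _; set b := pdt _ _; set c := pdx _ _; set d := pdx _ _.
move=> /eqP; rewrite eq_complex /= => /andP[/eqP E1 /eqP E2].
have hbar_neq0 : hbar != 0 by rewrite gt_eqF.
have m_neq0 : m != 0 by rewrite gt_eqF.
have -> : b = hbar / (2 * m) * c - V x * re (t, x) / hbar.
  apply: (mulfI hbar_neq0).
  (* This is the shape in which the complex product with [i * hbar] appears in [E1]. *)
  transitivity (- ((0 * hbar - 1 * 0) * a - (0 * 0 + 1 * hbar) * b)); first ring.
  by rewrite E1; field; rewrite m_neq0 hbar_neq0.
have -> : a = V x * im (t, x) / hbar - hbar / (2 * m) * d.
  apply: (mulfI hbar_neq0).
  transitivity ((0 * hbar - 1 * 0) * b + (0 * 0 + 1 * hbar) * a); first ring.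
  by rewrite E2; field; rewrite m_neq0 hbar_neq0.
rewrite /GRing.scale /= mulr0 addr0.
by field; rewrite m_neq0 hbar_neq0.
Qed.

End continuity_equation.

(** * The detection probability *)

Lemma flow_curve_integral (R : realType) (v : R * R -> R * R) (p : R * R) :
  complete_field v -> integral_curve v p setT (flow_curve v p).
Proof. by move=> vc; have [] := xgetPex (cst p) (vc p). Qed.

Unset Implicit Arguments.

Theorem proposition4 (R : realType) (m hbar : R) (V : R -> R)
    (Psi : R * R -> R[i]) (a b : R) :
  0 < m -> 0 < hbar ->
  class_CC 2 Psi ->
  schroedinger hbar m V Psi ->
  (forall p, Psi p != 0) ->
  (forall t : R,
     (\int[lebesgue_measure]_(xi in [set: R]) (density Psi (t, xi))%:E = 1)%E) ->
  complete_field (bohm_velocity hbar m Psi) ->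
  a < b ->
  let D : set (R * R) := [set p | p.2 \in `[a, b] /\ 0 <= p.1] in
  let P := detection_prob hbar m Psi D in
  let f_a := flux hbar m Psi a in
  let f_b := flux hbar m Psi b in
  (forall tau : R,
     measurable (fibre_proj (bohm_velocity hbar m Psi) @` upto D tau)) /\
  (forall tau : R, 0 <= tau ->
     exists Ma Mb : R,
       [/\ is_max [set f_a s | s in `[0, tau]] Ma,
           is_max [set - f_b s | s in `[0, tau]] Mb &
           P tau = P 0 + Ma + Mb]).
Proof.
move=> m0 h0 C2 Seq Psi0 Pint vc ab D P f_a f_b.
pose r := density Psi; pose j := current hbar m Psi.
pose X := fibre_proj (bohm_velocity hbar m Psi).
(* Any negative base time would serve: all times [t >= 0], including 0, then lie strictly above
   it. *)
pose F := potential r j (-1).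
have r0 p : 0 < r p by exact: density_gt0.
have cr : continuous r by exact: continuous_density.
have cj : continuous j by exact: continuous_current.
have N1lt0 : (-1 : R) < 0 by rewrite oppr_lt0.
have r_int : lebesgue_measure.-integrable [set: R] (EFin \o (fun x => r (-1, x))).
  apply/integrableP; split.
    apply/measurable_EFinP; apply: continuous_measurable_fun.
    exact: (@continuous_slice2 R r _ cr).
  under eq_integral do rewrite /= ger0_norm ?(ltW (r0 _))//.
  by rewrite Pint ltry.
have crt := continuous_density_dt C2.
have dr := is_derive_density C2.
have dj := is_derive_current m0 h0 C2 Seq.
have dF1 (t x : R) : -1 < t -> is_derive t (1 : R) (F^~ x) (- j (t, x)).
  exact: is_derive_potential1.
have dF2 (t x : R) : -1 < t -> is_derive x (1 : R) (F t) (r (t, x)).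
  exact: (is_derive_potential2 cr cj crt dr dj r_int).
have t_gtN1 (t : R) : 0 <= t -> -1 < t by exact: lt_le_trans.
have Finc t : 0 <= t -> {homo F t : x y / x < y}.
  move=> /t_gtN1 t1 x y xy.
  have [c _ Fxy] := MVT_segment (ltW xy) (fun z _ => dF2 t z t1)
    (itv_continuous_is_derive (fun z _ => dF2 t z t1)).
  by rewrite -subr_gt0 Fxy mulr_gt0 ?subr_gt0.
have F0c : continuous (F 0).
  by move=> x; exact: is_derive1_continuous (dF2 0 x N1lt0).
have Fc (tau x : R) : {within `[0, tau], continuous (F^~ x)}.
  apply: itv_continuous_is_derive => t; rewrite in_itv/= => /andP[t0 _].
  exact: dF1 (t_gtN1 t t0).
have FX p : 0 <= p.1 -> F 0 (X p) = F p.1 p.2.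
  apply: (potential_integral_curve dF1 dF2 cr _ _ N1lt0) => [q|].
    by rewrite gt_eqF.
  exact: flow_curve_integral.
(* [- F t c] is a primitive in [t] of the current through [x = c]. *)
have fluxE c s : 0 <= s -> flux hbar m Psi c s = F 0 c - F s c.
  move=> s0.
  have dNF (t : R) : t \in `[0, s] -> is_derive t (1 : R) (fun t => - F t c) (j (t, c)).
    rewrite in_itv/= => /andP[t0 _].
    by rewrite -(opprK (j _)); apply: is_deriveN; exact: dF1 (t_gtN1 t t0).
  rewrite /flux (continuous_Rintegral_itv_FTC2 s0 (@continuous_slice1 R j c cj) dNF).
  by rewrite opprK addrC.
(* From here on only the established properties of [F] matter, not its integral formula. *)
clearbody F.
have key tau : 0 <= tau -> exists ta tb,
    [/\ ta \in `[0, tau] /\ tb \in `[0, tau],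
        forall t, t \in `[0, tau] -> F ta a <= F t a,
        forall t, t \in `[0, tau] -> F t b <= F tb b,
        X @` upto D tau = `[X (ta, a), X (tb, b)]%classic &
        P tau = F tb b - F ta a].
  move=> tau0.
  have [ta taP amin] := EVT_min tau0 (Fc tau a).
  have [tb tbP bmax] := EVT_max tau0 (Fc tau b).
  exists ta, tb.
  have XD : X @` upto D tau = `[X (ta, a), X (tb, b)]%classic.
    exact: (fibre_image Finc F0c (Fc tau) FX (ltW ab) tau0 taP amin tbP bmax).
  split; [exact: (conj taP tbP)|exact: amin|exact: bmax|exact: XD|].
  have FXa : F 0 (X (ta, a)) = F ta a.
    by apply: FX; move: taP; rewrite in_itv/= => /andP[].
  have FXb : F 0 (X (tb, b)) = F tb b.
    by apply: FX; move: tbP; rewrite in_itv/= => /andP[].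
  (* Comparison at time 0: [F ta a <= F 0 a < F 0 b <= F tb b]. *)
  have Xab : X (ta, a) <= X (tb, b).
    have t00 : 0 \in `[0, tau] by rewrite in_itv/= lexx.
    rewrite -(le_mono (Finc 0 (lexx 0))) FXa FXb.
    exact: le_trans (amin 0 t00)
      (le_trans (ltW (Finc 0 (lexx 0) a b ab)) (bmax 0 t00)).
  (* [F 0] is a primitive of the density at time 0, so the mass of the segment is the difference of
     its values at the end points. *)
  rewrite /P /detection_prob -/X XD -FXa -FXb.
  exact: (continuous_Rintegral_itv_FTC2 Xab (@continuous_slice2 R r 0 cr)
    (fun x _ => dF2 0 x N1lt0)).
split=> [tau|tau tau0].
  have [tau0|tau0] := leP 0 tau.
    by have [ta [tb [_ _ _ -> _]]] := key tau tau0; exact: measurable_itv.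
  (* The detector is switched on at time 0, so nothing lies below a negative [tau]. *)
  rewrite (_ : upto D tau = set0) ?image_set0//.
  apply/seteqP; split=> // -[t x] [[_ /= t0] /= ttau].
  by move: (le_lt_trans (le_trans t0 ttau) tau0); rewrite ltxx.
have [ta [tb [[taP tbP] amin bmax _ Ptau]]] := key tau tau0.
have [ta' [tb' [[+ +] _ _ _ P0]]] := key 0 (lexx 0).
(* At [tau = 0] both extremal times are forced to be 0, so [P 0 = F 0 b - F 0 a]. *)
rewrite !in_itv/= -!eq_le => /eqP ta'0 /eqP tb'0.
have ge0 s : s \in `[0, tau] -> 0 <= s by rewrite in_itv/= => /andP[].
(* By [fluxE], [f_a] is largest where [F] is least on the side [a], and [- f_b] where [F] is
   greatest on the side [b]. *)
exists (F 0 a - F ta a), (F tb b - F 0 b); split.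
- split; first by exists ta => //=; rewrite /f_a fluxE// ge0.
  by move=> _ [s /= sP <-]; rewrite /f_a fluxE ?ge0// lerD2l lerN2 amin.
- split; first by exists tb => //=; rewrite /f_b fluxE ?opprB// ge0.
  by move=> _ [s /= sP <-]; rewrite /f_b fluxE ?ge0// opprB lerD2r bmax.
- rewrite Ptau P0 -ta'0 -tb'0; ring.
Qed.
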